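(* Let a nonlinear regression model with $m$ parameters, whose local $D$-optimal designs depend only on one component $\beta$ of the parameter, be given on a compact design space $\mathcal{X}$, with information matrices $M(\xi,\beta)$, $\beta\in\mathcal{B}=[\beta_{\min},\beta_{\max}]$, and local $D$-optimal designs $\xi[\beta]$, and let $Q(\beta,\tilde\beta)=|M(\xi[\tilde\beta],\beta)|/|M(\xi[\beta],\beta)|$ (see context). Assume that $Q$ is uniformly decreasing with respect to a scale $\ell$, where $\ell:\mathcal{B}\to\mathbb{R}$ is a nondecreasing continuous function; that is, (i) and (ii) hold, with $\varphi$ as specified in (i): (i) for all $\beta,\tilde\beta\in\mathcal{B}$, $Q(\beta,\tilde\beta)\le\varphi(\ell(\beta)-\ell(\tilde\beta))$, where $\varphi$ is a real-valued function satisfying $$\varphi(z)\le c_1|z|^{-\gamma}\qquad\text{with } c_1>0,\ \gamma>m;$$ (ii) there is a constant $\lambda>0$ such that $Q(\beta,\tilde\beta)\ge\frac12$ whenever $|\ell(\beta)-\ell(\tilde\beta)|\le\lambda$. Assume moreover: (iii) there is a constant $c_0$ such that for any $(x_1,\dots,x_m)\in\mathcal{X}^m$ there exist local $D$-optimal designs $\xi[\tilde\beta^{(1)}],\dots,\xi[\tilde\beta^{(m)}]$ with $\tilde\beta^{(1)},\dots,\tilde\beta^{(m)}\in\mathcal{B}$ such that $$|I_m(x_1,\dots,x_m,\beta)|\le c_0\sum_{j=1}^m|M(\xi[\tilde\beta^{(j)}],\beta)|\qquad\text{for all }\beta\in\mathcal{B}.$$ Let $N\in\mathbb{N}$ be given.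 If $\ell(\beta_{\max})-\ell(\beta_{\min})$ is sufficiently large, then the standardized maximin $D$-optimal design with respect to the interval $\mathcal{B}=[\beta_{\min},\beta_{\max}]$ is supported at more than $N$ points. Moreover, if the local $D$-optimal designs are minimally supported and the support contains only $m$ points, then the condition $\gamma>m$ in (i) can be replaced by $\gamma>m-m_\eta$, where $m_\eta$ is the number of points that are support points of every local $D$-optimal design in the model.
   Context: Setting. The response $Y$ is distributed as a member of the exponential family with $E[Y|x]=\eta(x,\theta)$, where $\theta\in\mathbb{R}^m$ is the unknown parameter, $x$ varies in a compact space $\mathcal{X}$, $\eta$ is continuously differentiable with respect to $\theta$, and the conditional variance $\mathrm{Var}[Y|x]$ exists. Observations under different experimental conditions are independent. The Fisher information at $x$ is $\frac{1}{\mathrm{Var}[Y|x]}\big(\frac{\partial\eta}{\partial\theta}(x,\theta)\big)\big(\frac{\partial\eta}{\partial\theta}(x,\theta)\big)^T\in\mathbb{R}^{m\times m}$. It is assumed that the local $D$-optimal design depends only on one component $\beta$ of $\theta$, and only this dependence is reflected in the notation: the Fisher information is written $I(x,\beta)=f(x,\beta)f^T(x,\beta)$ with $f(x,\beta)=(f_1(x,\beta),\dots,f_m(x,\beta))^T\in\mathbb{R}^m$. The interval $\mathcal{B}=[\beta_{\min},\beta_{\max}]$ represents the prior knowledge about the location of $\beta$. Designs. An (approximate) design $\xi$ is a probability measure on $\mathcal{X}$ with finite support $x_1,\dots,x_n$ and weights $w_1,\dots,w_n$. Its information matrix is $M(\xi,\beta)=\int_{\mathcal{X}}I(x,\beta)\,d\xi(x)=\sum_{k=1}^n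 w_kI(x_k,\beta)$. $|\cdot|$ applied to a matrix denotes the determinant. For each $\beta$, $\xi[\beta]$ denotes the local $D$-optimal design, i.e. the design maximizing $|M(\xi,\beta)|$ over all designs $\xi$. Criterion. A design is standardized maximin $D$-optimal with respect to $\mathcal{B}$ if it maximizes, over all designs $\xi$, $$\Phi(\xi)=\min\Big\{\frac{|M(\xi,\beta)|}{|M(\xi[\beta],\beta)|}\ \Big|\ \beta\in\mathcal{B}\Big\}.$$ Notation. For $x_1,\dots,x_m\in\mathcal{X}$, $I_m(x_1,\dots,x_m,\beta)=\big(\det(f_i(x_j,\beta))_{i,j=1}^m\big)^2$. The number $m_\eta\ge0$ of points that are support points of every local $D$-optimal design in the model is assumed to satisfy $m>m_\eta$. *)

(* Defs.v *)
From HB Require Import structures.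
From mathcomp Require Import all_boot all_order all_algebra finmap.
From mathcomp Require Import all_classical all_reals all_analysis.
Set Implicit Arguments.
Unset Strict Implicit.
Unset Printing Implicit Defensive.
Import Order.TTheory GRing.Theory Num.Theory.
Import numFieldNormedType.Exports.
Local Open Scope classical_set_scope.
Local Open Scope ring_scope.

(* A finitely supported probability measure \sum_k w_k \delta_(x_k), encoded  *)
(* by its mass function: [finsupp xi] is the set of support points x_k (those *)
(* of nonzero mass) and [xi x_k] is the weight w_k.                           *)
Record design (R : realType) (T : choiceType) := Design {
  weight :> {fsfun T -> R with 0};
  weight_ge0 : forall x, 0 <= weight x;
  weight_sum1 : \sum_(x <- finsupp weight) weight x = 1 }.

Definition nb_support (R : realType) (T : choiceType) (xi : design R T) : nat :=
  #|` finsupp xi|.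

(* The information I(x, p) is f(x, p) f(x, p)^T. The parameter type is left   *)
(* generic: it is R^m for the full parameter theta and R for the single       *)
(* component beta.                                                            *)
Section Information.
Variables (R : realType) (m : nat) (T : choiceType) (P : Type).
Variable f : T -> P -> 'cV[R]_m.

Definition info (x : T) (p : P) : 'M[R]_m := f x p *m (f x p)^T.

Definition info_mx (xi : design R T) (p : P) : 'M[R]_m :=
  \sum_(x <- finsupp xi) xi x *: info x p.

Definition local_D_optimal (xi : design R T) (p : P) : Prop :=
  forall xi' : design R T, \det (info_mx xi' p) <= \det (info_mx xi p).

Definition I_m (x : 'I_m -> T) (p : P) : R :=
  (\det (\matrix_(i < m, j < m) f (x j) p i 0)) ^+ 2.

End Information.

Definition grad (R : realType) (m : nat) (g : 'rV[R]_m -> R) (theta : 'rV[R]_m)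
    : 'cV[R]_m :=
  \col_(i < m) 'D_(delta_mx 0 i) g theta.

Definition regressor (R : realType) (m : nat) (T : Type)
    (eta var : T -> 'rV[R]_m -> R) (x : T) (theta : 'rV[R]_m) : 'cV[R]_m :=
  (Num.sqrt (var x theta))^-1 *: grad (eta x) theta.

(* The conditional distribution of the response Y enters only through its     *)
(* mean [eta x theta] and its variance [var x theta]. The set [params] of     *)
(* admissible parameters may be all of R^m.                                   *)
Record regression_model (R : realType) (m : nat) := RegressionModel {
  design_space :> topologicalType;
  design_space_compact : compact [set: design_space];
  params : set 'rV[R]_m;
  params_open : open params;
  eta : design_space -> 'rV[R]_m -> R;
  var : design_space -> 'rV[R]_m -> R;
  eta_differentiable : forall x theta, params theta ->
    differentiable (eta x) theta;
  eta_continuously_differentiable : forall x theta, params theta ->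
    {for theta, continuous (grad (eta x))};
  var_gt0 : forall x theta, params theta -> 0 < var x theta;
  beta_index : 'I_m;
  local_D_optimal_beta : forall theta theta', params theta -> params theta' ->
    theta 0 beta_index = theta' 0 beta_index ->
    forall xi : design R design_space,
      local_D_optimal (regressor eta var) xi theta <->
      local_D_optimal (regressor eta var) xi theta' }.

(* The information I of the model is the Fisher information.                  *)
Lemma info_regressor (R : realType) (m : nat) (mod : regression_model R m)
    (x : mod) (theta : 'rV[R]_m) : params mod theta ->
  info (regressor (@eta _ _ mod) (@var _ _ mod)) x theta =
  (var x theta)^-1 *: (grad (eta x) theta *m (grad (eta x) theta)^T).
Proof.
move=> th; rewrite /info /regressor linearZ /= -scalemxAl -scalemxAr scalerA.
by rewrite -invfM -expr2 sqr_sqrtr// ltW// var_gt0.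
Qed.

Definition set_component (R : realType) (m : nat) (i : 'I_m)
    (theta : 'rV[R]_m) (b : R) : 'rV[R]_m :=
  \row_j (if j == i then b else theta 0 j).

(* The components of theta other than beta are held at those of [nominal].    *)
(* [opt b] is the local D-optimal design xi[b]; when it is not unique, [opt]  *)
(* is a fixed choice. The values of [opt] outside [bmin, bmax] are irrelevant.*)
Record maximin_problem (R : realType) (m : nat) := MaximinProblem {
  model :> regression_model R m;
  nominal : 'rV[R]_m;
  bmin : R;
  bmax : R;
  bmin_le_bmax : bmin <= bmax;
  nominal_params : forall b, b \in `[bmin, bmax] ->
    params model (set_component (beta_index model) nominal b);
  opt : R -> design R model;
  opt_local_D_optimal : forall b, b \in `[bmin, bmax] ->
    local_D_optimal (regressor (@eta _ _ model) (@var _ _ model)) (opt b)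
      (set_component (beta_index model) nominal b) }.

Section Maximin.
Variables (R : realType) (m : nat) (P : maximin_problem R m).

Definition interval_B : set R := `[bmin P, bmax P].

Definition f (x : P) (b : R) : 'cV[R]_m :=
  regressor (@eta _ _ P) (@var _ _ P) x
    (set_component (beta_index P) (nominal P) b).

Definition M (xi : design R P) (b : R) : 'M[R]_m := info_mx f xi b.

Definition efficiency (xi : design R P) (b : R) : R :=
  \det (M xi b) / \det (M (opt P b) b).

Definition Q (b b' : R) : R := efficiency (opt P b') b.

(* The efficiencies are nonnegative, so this is a genuine infimum, equal to   *)
(* the minimum whenever the latter is attained.                               *)
Definition Phi (xi : design R P) : R :=
  inf [set efficiency xi b | b in interval_B].

Definition standardized_maximin (xi : design R P) : Prop :=
  forall xi' : design R P, Phi xi' <= Phi xi.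

Definition common_support : set P :=
  [set x | forall b, interval_B b -> x \in finsupp (opt P b)].

Definition is_scale (ell : R -> R) : Prop :=
  {in `[bmin P, bmax P] &, {homo ell : b b' / b <= b'}} /\
  {within `[bmin P, bmax P], continuous ell}.

(* z = 0 must be excluded from the bound on phi: |0|^(-gamma) is +oo in the   *)
(* intended meaning, whereas [powR] gives 0 `^ (- gamma) = 0.                 *)
Definition uniformly_decreasing (ell phi : R -> R) (c1 gamma lambda : R)
    : Prop :=
  [/\ forall b b', interval_B b -> interval_B b' ->
        Q b b' <= phi (ell b - ell b'),
      forall z, z != 0 -> phi z <= c1 * `|z| `^ (- gamma) &
      forall b b', interval_B b -> interval_B b' ->
        `|ell b - ell b'| <= lambda -> 2^-1 <= Q b b'].

Definition dominated_by_local_optimal (c0 : R) : Prop :=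
  forall x : 'I_m -> P, exists bt : 'I_m -> R,
    (forall j, interval_B (bt j)) /\
    forall b, interval_B b ->
      `|I_m f x b| <= c0 * \sum_(j < m) \det (M (opt P (bt j)) b).

Definition minimally_supported : Prop :=
  forall b, interval_B b -> nb_support (opt P b) = m.

End Maximin.

Arguments common_support {R m} P _ : rename.

(* Main.v *)
(* By the Cauchy-Binet formula, |M(xi, b)| is a sum over m-tuples of support  *)
(* points, weighted by products of weights, of the determinants I_m. If xi    *)
(* has at most N support points, (iii) therefore bounds its efficiency at b   *)
(* by a constant times the sum of at most N^m m values Q(b, bt); among any    *)
(* that many bt some b is at scale distance at least a fixed fraction of      *)
(* l = ell(bmax) - ell(bmin) from all of them, so Phi(xi) = O(l^-gamma).      *)
(* A uniform mixture of O(l / lambda) local optimal designs at scale spacing  *)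
(* lambda has, by (ii) and the monotonicity of the Cauchy-Binet sum in the    *)
(* weights, Phi at least of order l^-m. Putting a fixed mass on m_eta common  *)
(* support points improves this to l^-(m - m_eta) for minimally supported     *)
(* local optimal designs, since only m - m_eta factors then lose weight.      *)
Require Import Defs.
From mathcomp Require Import all_boot all_order all_algebra finmap.
From mathcomp Require Import all_classical all_reals all_analysis.
From mathcomp Require Import perm ring lra.
Import Order.TTheory GRing.Theory Num.Theory.
Import numFieldNormedType.Exports.
Local Open Scope classical_set_scope.
Local Open Scope card_scope.
Local Open Scope ring_scope.

(** Write l for the scale length. [Phi_le] gives at most A l^(-gamma) for every design with at most
    N support points, and [Phi_competitor] exhibits a design with at least B l^(-q), where q = m
    without anchor points and q = m - m_eta with them. As q < gamma, [powR_gap] shows that no such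
    design is optimal for large l. A and B involve only the given constants, so the threshold is
    uniform over all problems. *)

Section CauchyBinet.
Context {R : comNzRingType} {m : nat} {I : finType}.
Variables (u : I -> R) (a : I -> 'cV[R]_m).

Local Notation columns g := (\matrix_(i < m, j < m) a (g j) i 0).

(** Multilinearity in the rows: [g i] is the summand chosen in row i, where it leaves a multiple of
    the transpose of [a (g i)]. *)
Lemma det_gram_expand :
  \det (\sum_k u k *: (a k *m (a k)^T)) =
  \sum_(g : {ffun 'I_m -> I})
    (\prod_j u (g j)) * (\prod_j a (g j) j 0) * \det (columns g).
Proof.
pose F i j k := u k * (a k i 0 * a k j 0).
have entry i j : (\sum_k u k *: (a k *m (a k)^T)) i j = \sum_k F i j k.
  by rewrite summxE; apply: eq_bigr => k _; rewrite !mxE big_ord1 mxE.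
transitivity (\sum_(s : 'S_m) \sum_(g : {ffun 'I_m -> I})
    (-1) ^+ s * \prod_i F i (s i) (g i)).
  apply: eq_bigr => s _; rewrite -mulr_sumr; congr (_ * _).
  rewrite -(bigA_distr_bigA (fun i k => F i (s i) k)) /=.
  by apply: eq_bigr => i _; rewrite entry.
rewrite exchange_big; apply: eq_bigr => g _ /=.
rewrite -det_tr /determinant mulr_sumr; apply: eq_bigr => s _.
rewrite !big_split /= mulrCA mulrA [RHS]mulrCA; congr (_ * _).
congr (_ * _); first exact: mulrC.
by apply: eq_bigr => i _; rewrite !mxE.
Qed.

(* Averaging the expansion over all reorderings of [g] turns the diagonal     *)
(* product into a second determinant.                                         *)
Lemma det_gram :
  m`!%:R * \det (\sum_k u k *: (a k *m (a k)^T)) =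
  \sum_(g : {ffun 'I_m -> I}) (\prod_j u (g j)) * \det (columns g) ^+ 2.
Proof.
transitivity (\sum_(s : 'S_m) \sum_(g : {ffun 'I_m -> I})
    (\prod_j u (g j)) * ((-1) ^+ s * \prod_j a (g (s j)) j 0) *
      \det (columns g)).
  rewrite -card_Sn mulr_natl -sumr_const; apply: eq_bigr => s _.
  rewrite det_gram_expand.
  pose h (g : {ffun 'I_m -> I}) := [ffun j => g (s j)].
  have hI : injective h.
    move=> g g' /ffunP e; apply/ffunP => j.
    by have := e (s^-1 j)%g; rewrite !ffunE permKV.
  rewrite (reindex_inj hI) /=; apply: eq_bigr => g _.
  have -> : \prod_j u (h g j) = \prod_j u (g j).
    rewrite [RHS](reindex_inj (@perm_inj _ s)) /=.
    by apply: eq_bigr => j _; rewrite ffunE.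
  have -> : \det (columns (h g)) = (-1) ^+ s * \det (columns g).
    have -> : columns (h g) = col_perm s (columns g).
      by apply/matrixP => i j; rewrite !mxE ffunE.
    by rewrite col_permE det_mulmx det_perm odd_permV mulrC.
  rewrite [in RHS](mulrC _ (\prod_j _)) !mulrA; congr (_ * _ * _ * _).
  by apply: eq_bigr => j _; rewrite ffunE.
rewrite exchange_big; apply: eq_bigr => g _ /=.
rewrite -mulr_suml -mulr_sumr expr2 mulrA; congr (_ * _ * _).
apply: eq_bigr => s _; congr (_ * _).
by apply: eq_bigr => i _; rewrite !mxE.
Qed.

End CauchyBinet.

(** * Determinants of information matrices *)

(** Allows two designs with different supports to be expanded over a common index type. *)
Lemma big_fsfun_sub {R : realType} {V : lmodType R} {T : choiceType}
    (xi : {fsfun T -> R with 0}) (S : {fset T}) (F : T -> V) :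
  (finsupp xi `<=` S)%fset ->
  \sum_(x <- finsupp xi) xi x *: F x = \sum_(x : S) xi (val x) *: F (val x).
Proof.
move=> sub; rewrite (big_fset_incl _ sub); first by rewrite big_seq_fsetE.
by move=> x _ /fsfun_dflt->; rewrite scale0r.
Qed.

Section DesignDeterminant.
Context {R : realType} {m : nat} {T : choiceType} {P : Type}.
Variables (f : T -> P -> 'cV[R]_m) (p : P).

Lemma I_m_ge0 (x : 'I_m -> T) : 0 <= I_m f x p.
Proof. exact: sqr_ge0. Qed.

Lemma I_m_noninjective (x : 'I_m -> T) : ~ injective x -> I_m f x p = 0.
Proof.
move=> ninj; rewrite /I_m.
have [i [j [xij /eqP ij]]] : exists i j, x i = x j /\ i <> j.
  apply: contrapT => h; apply: ninj => i j xij.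
  by apply: contrapT => ij; apply: h; exists i, j.
rewrite -det_tr (determinant_alternate ij) ?expr0n//.
by move=> k; rewrite !mxE xij.
Qed.

Lemma det_info_mx (xi : design R T) (S : {fset T}) :
  (finsupp xi `<=` S)%fset ->
  m`!%:R * \det (info_mx f xi p) =
  \sum_(g : {ffun 'I_m -> S})
    (\prod_j xi (val (g j))) * I_m f (fun j => val (g j)) p.
Proof. by move=> sub; rewrite /info_mx (big_fsfun_sub _ _ _ sub) det_gram. Qed.

Lemma fact_gt0R : 0 < m`!%:R :> R.
Proof. by rewrite ltr0n fact_gt0. Qed.

Lemma det_info_mx_ge0 (xi : design R T) : 0 <= \det (info_mx f xi p).
Proof.
rewrite -(pmulr_rge0 _ fact_gt0R) (det_info_mx xi _ (fsubset_refl _)).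
apply: sumr_ge0 => g _; apply: mulr_ge0 (I_m_ge0 _).
by apply: prodr_ge0 => j _; apply: weight_ge0.
Qed.

Lemma weight_le1 (xi : design R T) (x : T) : xi x <= 1.
Proof.
have [xs|/fsfun_dflt->//] := boolP (x \in finsupp xi).
rewrite -(weight_sum1 xi) (big_fsetD1 x)//= lerDl.
by apply: sumr_ge0 => y _; apply: weight_ge0.
Qed.

(** Crude but free of the weights: each weight is at most 1 and m! is at least 1. Only the number of
    tuples still depends on the design. *)
Lemma det_info_mx_le (xi : design R T) :
  \det (info_mx f xi p) <=
  \sum_(g : {ffun 'I_m -> finsupp xi}) I_m f (fun j => val (g j)) p.
Proof.
apply: (@le_trans _ _ (m`!%:R * \det (info_mx f xi p))).
  by rewrite ler_peMl ?det_info_mx_ge0// ler1n fact_gt0.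
rewrite (det_info_mx xi _ (fsubset_refl _)); apply: ler_sum => g _.
rewrite ler_piMl ?I_m_ge0//; apply: prodr_ile1 => j _.
by rewrite weight_ge0 weight_le1.
Qed.

(** All Cauchy-Binet terms are nonnegative, so they can be compared one by one. Tuples with a
    repeated point vanish on both sides, and those leaving the support of [xi] vanish on the
    left. *)
Lemma det_info_mx_ge (xi xi' : design R T) (r : R) :
  (forall x : 'I_m -> T, injective x -> (forall j, x j \in finsupp xi) ->
    r * \prod_j xi (x j) <= \prod_j xi' (x j)) ->
  r * \det (info_mx f xi p) <= \det (info_mx f xi' p).
Proof.
move=> h; pose S := (finsupp xi `|` finsupp xi')%fset.
rewrite -(ler_pM2l fact_gt0R) mulrCA (det_info_mx xi S (fsubsetUl _ _)).
rewrite (det_info_mx xi' S (fsubsetUr _ _)) mulr_sumr; apply: ler_sum => g _.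
rewrite mulrA; have [inj|/I_m_noninjective->] :=
  pselect (injective (fun j => val (g j))); last by rewrite !mulr0.
apply: ler_wpM2r; first exact: I_m_ge0.
have [gs|] := boolP [forall j, val (g j) \in finsupp xi].
  by apply: h => //; apply/forallP.
case/forallPn => j /fsfun_dflt xj0.
rewrite (bigD1 j)//= xj0 mul0r mulr0.
by apply: prodr_ge0 => k _; apply: weight_ge0.
Qed.

End DesignDeterminant.

(** * Mixtures of designs with additional anchor points *)

Section Designs.
Context {R : realType} {T : choiceType}.

Lemma sum_weight (xi : design R T) (S : {fset T}) :
  (finsupp xi `<=` S)%fset -> \sum_(x <- S) xi x = 1.
Proof.
move=> sub; rewrite -(big_fset_incl _ sub) ?weight_sum1//.
by move=> x _ /fsfun_dflt->.
Qed.

Lemma nb_support_gt0 (xi : design R T) : (0 < nb_support xi)%N.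
Proof.
rewrite cardfs_gt0; apply/eqP => xi0.
have := weight_sum1 xi; rewrite xi0 big_seq_fset0.
by move/eqP; rewrite eq_sym oner_eq0.
Qed.

Lemma design_of_fun (w : T -> R) (S : {fset T}) :
  (forall x, 0 <= w x) -> (forall x, x \notin S -> w x = 0) ->
  \sum_(x <- S) w x = 1 -> exists xi : design R T, forall x, xi x = w x.
Proof.
move=> w0 wS w1; pose h := [fsfun x in S => w x | 0] : {fsfun T -> R with 0}.
have hE x : h x = w x.
  by rewrite /h fsfun_fun; case: ifPn => // /wS->.
have h0 x : 0 <= h x by rewrite hE.
have h1 : \sum_(x <- finsupp h) h x = 1.
  have sub : (finsupp h `<=` S)%fset.
    apply/fsubsetP => x; rewrite mem_finsupp hE.
    by apply: contraR => /wS->.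
  rewrite (big_fset_incl _ sub); last by move=> x _ /fsfun_dflt.
  by rewrite -w1; apply: eq_bigr => x _.
by exists (Design h0 h1).
Qed.

(** Unit mass at each point of [C] plus the uniform mixture has total mass |C| + 1, whence the
    normalization. *)
Lemma anchored_mixture (C : {fset T}) (K : nat) (xs : 'I_K.+1 -> design R T) :
  exists xi : design R T, forall x,
    xi x = (#|` C|.+1)%:R^-1 *
             ((x \in C)%:R + K.+1%:R^-1 * \sum_i xs i x).
Proof.
pose S := (C `|` \big[@fsetU T/fset0]_(i < K.+1) finsupp (xs i))%fset.
have sub i : (finsupp (xs i) `<=` S)%fset.
  apply: fsubset_trans (fsubsetUr _ _).
  exact: (bigfcup_sup _ (mem_index_enum i)).
apply: (@design_of_fun _ S).
- move=> x; apply: mulr_ge0; first by rewrite invr_ge0 ler0n.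
  apply: addr_ge0; first by rewrite ler0n.
  apply: mulr_ge0; first by rewrite invr_ge0 ler0n.
  by apply: sumr_ge0 => i _; apply: weight_ge0.
- move=> x; rewrite in_fsetU negb_or => /andP[/negbTE-> xS].
  rewrite big1 ?mulr0 ?addr0 ?mulr0// => i _; apply: fsfun_dflt.
  apply: contra xS => xi; apply/bigfcupP; exists i => //.
  by rewrite mem_index_enum.
- rewrite -mulr_sumr big_split /= -mulr_sumr exchange_big /=.
  have -> : \sum_j \sum_(x <- S) xs j x = \sum_(j < K.+1) 1.
    by apply: eq_bigr => i _; apply: sum_weight.
  rewrite sumr_const card_ord mulVf ?pnatr_eq0//.
  have -> : \sum_(x <- S) (x \in C)%:R = #|` C|%:R :> R.
    rewrite -(big_fset_incl _ (fsubsetUl C _)); last by move=> x _ /negbTE->.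
    rewrite big_seq (eq_bigr (fun=> 1%:R)); last by move=> x ->.
    by rewrite -big_seq -natr_sum card_fset_sum1.
  by rewrite -natr1 mulVf// natr1 pnatr_eq0.
Qed.

(** Every point loses the factor 1/(|C| + 1), but only points outside [C] also lose 1/(K + 1), and a
    tuple has at most [q] of these. *)
Lemma det_anchored_mixture_ge {m : nat} {P : Type} (f : T -> P -> 'cV[R]_m)
    (p : P) (C : {fset T}) (K q : nat) (xs : 'I_K.+1 -> design R T)
    (xi : design R T) (i : 'I_K.+1) :
  (forall x, xi x = (#|` C|.+1)%:R^-1 *
                    ((x \in C)%:R + K.+1%:R^-1 * \sum_i xs i x)) ->
  (forall x : 'I_m -> T, injective x ->
     (forall j, x j \in finsupp (xs i)) -> (#|[pred j | x j \notin C]| <= q)%N) ->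
  (#|` C|.+1)%:R^-1 ^+ m * K.+1%:R^-1 ^+ q * \det (info_mx f (xs i) p)
    <= \det (info_mx f xi p).
Proof.
move=> xiE hq; apply: det_info_mx_ge => x xinj xsupp.
set c := _.+1%:R^-1; set k := K.+1%:R^-1.
have c0 : 0 <= c :> R by rewrite invr_ge0.
have k0 : 0 <= k :> R by rewrite invr_ge0.
have k1 : k <= 1 :> R by rewrite invf_le1 ?ltr0n// ler1n.
pose r j : R := if x j \notin C then k else 1.
have rE : \prod_j r j = k ^+ #|[pred j | x j \notin C]|.
  by rewrite -big_mkcond prodr_const.
apply: (@le_trans _ _ (\prod_j (c * r j * xs i (x j)))).
  rewrite !big_split /= prodr_const card_ord rE.
  apply: ler_wpM2r; first by apply: prodr_ge0 => j _; apply: weight_ge0.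
  apply: ler_wpM2l; first exact: exprn_ge0.
  by apply: ler_wiXn2l => //; apply: hq.
apply: ler_prod => j _; have w0 y n := weight_ge0 (xs n) y.
have r0 : 0 <= r j by rewrite /r; case: ifP.
rewrite !mulr_ge0//= xiE -/c -/k -mulrA; apply: ler_wpM2l => //.
have ws : xs i (x j) <= \sum_i xs i (x j).
  by rewrite (bigD1 i)//= lerDl; apply: sumr_ge0.
rewrite /r; case: ifPn => [/negbTE->|]; first by rewrite add0r ler_wpM2l.
(* On [C] the unit mass alone dominates the weight in [xs i], which is at most 1. *)
rewrite negbK => ->; rewrite mul1r (le_trans (weight_le1 _ _))// lerDl.
by rewrite mulr_ge0// (le_trans _ ws).
Qed.

Lemma card_avoiding_le {m : nat} (C S : {fset T}) (x : 'I_m -> T) :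
  (C `<=` S)%fset -> injective x -> (forall j, x j \in S) ->
  (#|[pred j | x j \notin C]| <= #|` S| - #|` C|)%N.
Proof.
move=> CS xinj xS.
have <- : #|` (S `\` C)%fset| = (#|` S| - #|` C|)%N.
  by rewrite cardfsD (fsetIidPr CS).
rewrite cardE -(size_map x).
apply: uniq_leq_size; first by rewrite map_inj_uniq ?enum_uniq.
move=> y /mapP[j]; rewrite mem_enum inE => xj ->.
by rewrite in_fsetD xj xS.
Qed.

End Designs.

(** * Pigeonhole on the scale axis and comparison of powers *)

(** Take K + 1 points from lo to hi at spacing 2d, with d = (hi - lo)/(2K). An open ball of radius d
    contains at most one of them, so at most K balls miss some point. *)
Lemma far_point {R : realType} {I : finType} (t : I -> R) (K : nat)
    (lo hi : R) :
  (0 < K)%N -> (#|I| <= K)%N -> lo < hi ->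
  exists2 v, lo <= v <= hi &
    forall i, (hi - lo) / (2 * K%:R) <= `|v - t i|.
Proof.
move=> K0 IK lohi; set d := (hi - lo) / _.
have K0R : 0 < K%:R :> R by rewrite ltr0n.
have d0 : 0 < d by rewrite divr_gt0 ?mulr_gt0 ?subr_gt0.
have dK : 2 * d * K%:R = hi - lo by rewrite /d; field; rewrite gt_eqF.
clearbody d.
pose v (k : 'I_K.+1) := lo + k%:R * (2 * d).
have [[k hk]|no] := pselect (exists k, forall i, d <= `|v k - t i|).
  exists (v k) => //; rewrite /v lerDl mulr_ge0 ?mulr_ge0 ?(ltW d0)//=.
  rewrite -lerBrDl -dK [leLHS]mulrC ler_pM2l ?mulr_gt0// ler_nat.
  by rewrite -ltnS.
have /choice[h hE] k : exists i, `|v k - t i| < d.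
  apply: contrapT => nk; apply: no; exists k => i.
  by rewrite leNgt; apply/negP => lt; apply: nk; exists i.
suff /leq_card : injective h by rewrite card_ord leqNgt ltnS IK.
have step (k k' : 'I_K.+1) : h k = h k' -> (k' <= k)%N.
  move=> e; have := hE k; have := hE k'; rewrite -e => /ltr_normlP[_ a1].
  move=> /ltr_normlP[b1 _].
  have : (k'%:R - k%:R) * (2 * d) < 1 * (2 * d).
    by move: a1 b1; rewrite /v; lra.
  by rewrite ltr_pM2r ?mulr_gt0// ltrBlDl natr1 ltr_nat ltnS.
by move=> k k' e; apply/val_inj/anti_leq; rewrite !step.
Qed.

Lemma powR_gap {R : realType} (A B gamma : R) (q : nat) :
  0 <= A -> 0 < B -> q%:R < gamma ->
  exists L : R, forall l, L <= l -> A * l `^ (- gamma) < B * l ^- q.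
Proof.
move=> A0 B0 qg; have gq : 0 < gamma - q%:R by rewrite subr_gt0.
(* The 1 keeps l positive; adding 1 to A/B makes the final inequality strict. *)
exists (Num.max 1 ((A / B + 1) `^ (gamma - q%:R)^-1)) => l.
rewrite ge_max => /andP[l1 lL]; have l0 : 0 < l by apply: lt_le_trans l1.
have AB : 0 <= A / B + 1 by rewrite addr_ge0 ?divr_ge0// ltW.
have big : A / B < l `^ (gamma - q%:R).
  apply: (@lt_le_trans _ _ (A / B + 1)); first by rewrite ltrDl.
  have -> : A / B + 1 = ((A / B + 1) `^ (gamma - q%:R)^-1) `^ (gamma - q%:R).
    by rewrite -powRrM mulVf ?powRr1// lt0r_neq0.
  by apply: (@ge0_ler_powR R _ (ltW gq) _ _ _ _ lL); rewrite nnegrE ?powR_ge0 ?(ltW l0).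
have <- : l `^ (gamma - q%:R) * l `^ (- gamma) = l ^- q.
  rewrite -powRD; last by rewrite (lt0r_neq0 l0) implybT.
  by rewrite addrAC subrr add0r powRN powR_mulrn// ltW.
rewrite mulrA ltr_pM2r ?powR_gt0//.
by rewrite mulrC -ltr_pdivrMr.
Qed.

(** * Upper and lower bounds for the criterion *)

Section Problem.
Context {R : realType} {m : nat} (P : maximin_problem R m).

Lemma efficiency_ge0 (xi : design R P) (b : R) : 0 <= efficiency xi b.
Proof. by rewrite divr_ge0 ?det_info_mx_ge0. Qed.

Lemma Phi_le_efficiency (xi : design R P) (b : R) :
  interval_B P b -> Phi xi <= efficiency xi b.
Proof.
move=> Bb; apply: ge_inf; last by exists b.
by exists 0 => _ [b' _ <-]; apply: efficiency_ge0.
Qed.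

Lemma le_Phi (xi : design R P) (c : R) :
  (forall b, interval_B P b -> c <= efficiency xi b) -> c <= Phi xi.
Proof.
move=> h; apply: lb_le_inf.
  exists (efficiency xi (bmin P)), (bmin P) => //.
  by rewrite /interval_B /= in_itv /= lexx bmin_le_bmax.
by move=> _ [b Bb <-]; apply: h.
Qed.

Context {ell phi : R -> R} {c1 gamma lambda : R}.
Hypothesis scale : is_scale P ell.
Hypothesis decr : uniformly_decreasing P ell phi c1 gamma lambda.

Local Notation range := (ell (bmax P) - ell (bmin P)).

Lemma scale_onto (v : R) : ell (bmin P) <= v <= ell (bmax P) ->
  exists2 b, interval_B P b & ell b = v.
Proof.
case: scale => mono cont /andP[v1 v2].
apply: (IVT (bmin_le_bmax P) cont).
by rewrite ge_min v1 le_max v2 orbT.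
Qed.

Lemma scale_bounds (b : R) : interval_B P b ->
  ell (bmin P) <= ell b <= ell (bmax P).
Proof.
case: scale => mono _ Bb; have /andP[b1 b2] : bmin P <= b <= bmax P by [].
have le := bmin_le_bmax P.
by rewrite !mono ?in_itv/= ?lexx ?b1 ?b2 ?le.
Qed.

(** Nondegeneracy comes from (ii) at equal parameters: division by zero returns 0, which would
    contradict [2^-1 <= Q b b]. *)
Lemma det_opt_gt0 (b : R) : 0 <= lambda -> interval_B P b ->
  0 < \det (M (opt P b) b).
Proof.
move=> l0 Bb; case: decr => _ _ /(_ b b Bb Bb).
rewrite subrr normr0 => /(_ l0) Qbb.
rewrite lt0r det_info_mx_ge0 andbT; apply: contraTneq Qbb => d0.
by rewrite /Q /efficiency d0 invr0 mulr0 -ltNge invr_gt0.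
Qed.

(* The Cauchy-Binet formula and (iii) bound the efficiency by boundedly many  *)
(* values Q(b, bt); the pigeonhole point b is far from all the bt's in scale. *)
Lemma Phi_le (N K : nat) (c0 : R) (xi : design R P) :
  (0 < m)%N -> 0 <= gamma -> 0 <= c1 -> 0 <= lambda -> 0 < range ->
  dominated_by_local_optimal P c0 -> (nb_support xi <= N)%N -> K = (N ^ m * m)%N ->
  Phi xi <= `|c0| * (K%:R * (c1 * (range / (2 * K%:R)) `^ (- gamma))).
Proof.
move=> m0 g0 c10 l0 r0 dom xiN KE; have [bt btE] := choice dom.
case: decr => Qphi phic _.
pose G := {ffun 'I_m -> finsupp xi}.
pose t (i : (G * 'I_m)%type) := bt (fun j => val (i.1 j)) i.2.
have Bt i : interval_B P (t i) by have [h _] := btE (fun j => val (i.1 j)); apply: h.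
have cardG : (#|{: G * 'I_m}| <= K)%N.
  rewrite KE card_prod card_ffun card_ord leq_mul2r -cardfE.
  by rewrite leq_exp2r// xiN orbT.
have K0 : (0 < K)%N.
  by rewrite KE muln_gt0 expn_gt0 m0 (leq_trans (nb_support_gt0 xi) xiN).
have lohi : ell (bmin P) < ell (bmax P) by rewrite -subr_gt0.
have [v vB far] := far_point (ell \o t) _ _ _ K0 cardG lohi.
have [b Bb bv] := scale_onto _ vB.
apply: le_trans (Phi_le_efficiency _ _ Bb) _.
set d := range / _ in far *.
have d0 : 0 < d by rewrite divr_gt0 ?mulr_gt0 ?ltr0n.
have Qle i : Q P b (t i) <= c1 * d `^ (- gamma).
  have /= dle := far i; rewrite -bv in dle.
  (* The decay bound on [phi] is available only at nonzero arguments. *)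
  have n0 : 0 < `|ell b - ell (t i)| by apply: lt_le_trans dle.
  apply: le_trans (Qphi _ _ Bb (Bt i)) _.
  apply: le_trans (phic _ _) _; first by rewrite -normr_gt0.
  apply: ler_wpM2l => //; rewrite !powRN lef_pV2 ?posrE ?powR_gt0//.
  by apply: (ge0_ler_powR g0) dle; rewrite nnegrE ltW.
have dopt := det_opt_gt0 _ l0 Bb.
have : efficiency xi b <= \sum_i `|c0| * Q P b (t i).
  rewrite /efficiency ler_pdivrMr// mulr_suml.
  apply: le_trans (det_info_mx_le _ _ _) _.
  rewrite -(pair_bigA _ (fun g j => `|c0| * Q P b (t (g, j)) *
    \det (M (opt P b) b))) /=; apply: ler_sum => g _.
  apply: le_trans (ler_norm _) _.
  have [_ /(_ b Bb) h] := btE (fun j => val (g j)).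
  apply: le_trans h _; rewrite mulr_sumr; apply: ler_sum => j _.
  rewrite -mulrA /Q /efficiency divfK ?gt_eqF//.
  by apply: ler_wpM2r; rewrite ?det_info_mx_ge0// ler_norm.
move/le_trans; apply; rewrite -mulr_sumr; apply: ler_wpM2l => //.
apply: le_trans (ler_sum _ (fun i _ => Qle i)) _.
rewrite sumr_const -[leLHS]mulr_natl; apply: ler_wpM2r; last by rewrite ler_nat.
by rewrite mulr_ge0 ?powR_ge0.
Qed.

(* Competitor: mix local optimal designs taken at scale spacing [lambda], and *)
(* add mass at points [C] common to all of them, so that those weights do not *)
(* decrease as the number of mixed designs grows.                             *)
Lemma Phi_competitor (C : {fset P}) (q : nat) :
  0 < lambda -> lambda <= range ->
  (forall b (x : 'I_m -> P), interval_B P b -> injective x ->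
     (forall j, x j \in finsupp (opt P b)) ->
     (#|[pred j | x j \notin C]| <= q)%N) ->
  exists xi : design R P,
    (#|` C|.+1)%:R^-1 ^+ m * (lambda / 2) ^+ q / 2 * range ^- q <= Phi xi.
Proof.
move=> l0 lr hq; have r0 : 0 < range by apply: lt_le_trans lr.
(* The largest K for which all grid values ell(bmin) + i lambda, i <= K, stay in the range of the
   scale. *)
pose K := Num.Def.trunc (range / lambda).
have rl0 : 0 <= range / lambda by rewrite divr_ge0 ?ltW.
have /andP[Kle _] := trunc_itv rl0; rewrite -/K in Kle.
pose v (i : 'I_K.+1) := ell (bmin P) + i%:R * lambda.
have vB i : ell (bmin P) <= v i <= ell (bmax P).
  rewrite /v lerDl mulr_ge0 ?(ltW l0)//= -lerBrDl -ler_pdivlMr//.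
  by apply: le_trans Kle; rewrite ler_nat -ltnS.
have /choice[b bE] i : exists b, interval_B P b /\ ell b = v i.
  by have [b Bb bv] := scale_onto _ (vB i); exists b.
have [xi xiE] := anchored_mixture C _ (fun i => opt P (b i)).
exists xi; apply: le_Phi => b' Bb'.
have /andP[lo hi] := scale_bounds _ Bb'.
pose z := (ell b' - ell (bmin P)) / lambda.
have z0 : 0 <= z by rewrite divr_ge0 ?subr_ge0 ?(ltW l0).
have /andP[z1 z2] := trunc_itv z0.
have zK : (Num.Def.trunc z < K.+1)%N.
  rewrite ltnS; apply: le_truncn.
  by rewrite ler_pM2r ?invr_gt0// lerD2r.
(* The last grid value not exceeding [ell b'], hence within [lambda] of it. *)
pose i := Ordinal zK.
have [Bbi bi] := bE i.
have near : `|ell b' - ell (b i)| <= lambda.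
  rewrite bi /v /=; have -> : ell b' = ell (bmin P) + z * lambda.
    by rewrite /z divfK ?gt_eqF// addrC subrK.
  rewrite opprD addrACA subrr add0r -mulrBl ger0_norm.
    by rewrite ler_piMl ?(ltW l0)// lerBlDl natr1 ltW.
  by rewrite mulr_ge0 ?subr_ge0 ?(ltW l0).
case: decr => _ _ /(_ b' (b i) Bb' Bbi near) Qge.
have step := det_anchored_mixture_ge (@f R m P) b' C K q _ xi i xiE
  (fun x inj xs => hq _ x Bbi inj xs).
have dopt := det_opt_gt0 _ (ltW l0) Bb'.
apply: (@le_trans _ _ ((#|` C|.+1)%:R^-1 ^+ m * K.+1%:R^-1 ^+ q * Q P b' (b i))).
  (* K + 1 <= 2 range / lambda, because [lambda <= range] allows the 1 to be absorbed. *)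
  have kge : lambda / 2 / range <= K.+1%:R^-1.
    rewrite -invf_div lef_pV2 ?posrE ?divr_gt0// -natr1.
    have : 1 <= range / lambda by rewrite ler_pdivlMr ?mul1r.
    have -> : range / (lambda / 2) = range / lambda + range / lambda.
      by field; rewrite gt_eqF.
    by move=> ?; apply: lerD.
  have -> : (#|` C|.+1)%:R^-1 ^+ m * (lambda / 2) ^+ q / 2 * range ^- q =
      (#|` C|.+1)%:R^-1 ^+ m * (lambda / 2 / range) ^+ q * 2^-1 :> R.
    by rewrite [in RHS]expr_div_n mulrA mulrAC.
  have h0 : 0 <= (#|` C|.+1)%:R^-1 ^+ m :> R.
    by rewrite exprn_ge0// invr_ge0 ler0n.
  have rl : 0 <= lambda / 2 / range by rewrite ltW// !divr_gt0.
  apply: ler_pM => //; first by rewrite mulr_ge0 ?exprn_ge0.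
  by apply: ler_wpM2l => //; apply: lerXn2r; rewrite // nnegrE ?invr_ge0.
by rewrite /Q /efficiency mulrA ler_pM2r ?invr_gt0.
Qed.

End Problem.

(** Treats both claims at once: [C] is empty with q = m, or the common support with q = m - m_eta.
    The threshold is fixed before the problem, so only the size [k] of [C] may enter it. *)
Lemma standardized_maximin_support_gt {R : realType} (m k q N : nat)
    (c0 c1 gamma lambda : R) :
  (0 < m)%N -> 0 < c1 -> 0 < lambda -> q%:R < gamma ->
  exists L : R, forall (P : maximin_problem R m) (ell phi : R -> R)
      (C : {fset P}),
    #|` C| = k ->
    (forall b (x : 'I_m -> P), interval_B P b -> injective x ->
       (forall j, x j \in finsupp (opt P b)) ->
       (#|[pred j | x j \notin C]| <= q)%N) ->
    is_scale P ell ->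
    uniformly_decreasing P ell phi c1 gamma lambda ->
    dominated_by_local_optimal P c0 ->
    L <= ell (bmax P) - ell (bmin P) ->
    forall xi : design R P, standardized_maximin xi ->
      (N < nb_support xi)%N.
Proof.
move=> m0 c10 l0 qg; pose K := (N ^ m * m)%N.
(* [A] and [B] are the coefficients of range^(-gamma) in [Phi_le] and of range^(-q) in
   [Phi_competitor]. *)
pose A := `|c0| * (K%:R * (c1 * (2 * K%:R)^-1 `^ (- gamma))).
pose B := k.+1%:R^-1 ^+ m * (lambda / 2) ^+ q / 2.
have A0 : 0 <= A by rewrite !mulr_ge0 ?powR_ge0 ?(ltW c10).
have B0 : 0 < B by rewrite divr_gt0 ?mulr_gt0 ?exprn_gt0 ?invr_gt0 ?divr_gt0.
have g0 : 0 <= gamma by apply: le_trans (ltW qg).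
have [L gap] := powR_gap A B gamma q A0 B0 qg.
exists (Num.max lambda L) => P ell phi C Ck hq scale decr dom.
rewrite ge_max => /andP[lr Lr] xi opt_xi.
have r0 := lt_le_trans l0 lr.
rewrite ltnNge; apply/negP => xiN.
have := Phi_le P scale decr N K c0 xi m0 g0 (ltW c10) (ltW l0) r0 dom xiN erefl.
have [xi'] := Phi_competitor P scale decr C q l0 lr hq.
rewrite Ck => low up; have := le_trans low (le_trans (opt_xi xi') up).
rewrite leNgt => /negP; apply; apply: le_lt_trans (gap _ Lr).
rewrite powRM ?(ltW r0) ?invr_ge0//.
by rewrite le_eqVlt; apply/orP; left; apply/eqP; rewrite /A; ring.
Qed.

Theorem theorem3p1 (R : realType) (m m_eta N : nat) (c0 c1 gamma lambda : R)
    (m_eta_lt_m : (m_eta < m)%N) (c1_gt0 : 0 < c1) (lambda_gt0 : 0 < lambda) :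
  (m%:R < gamma ->
   exists L : R, forall (P : maximin_problem R m) (ell phi : R -> R),
     common_support P #= `I_m_eta ->
     is_scale P ell ->
     uniformly_decreasing P ell phi c1 gamma lambda ->
     dominated_by_local_optimal P c0 ->
     L <= ell (bmax P) - ell (bmin P) ->
     forall xi : design R P, standardized_maximin xi ->
       (N < nb_support xi)%N)
  /\
  (m%:R - m_eta%:R < gamma ->
   exists L : R, forall (P : maximin_problem R m) (ell phi : R -> R),
     common_support P #= `I_m_eta ->
     minimally_supported P ->
     is_scale P ell ->
     uniformly_decreasing P ell phi c1 gamma lambda ->
     dominated_by_local_optimal P c0 ->
     L <= ell (bmax P) - ell (bmin P) ->
     forall xi : design R P, standardized_maximin xi ->
       (N < nb_support xi)%N).
Proof.
have m0 : (0 < m)%N by apply: leq_ltn_trans m_eta_lt_m.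
split=> gt_gamma.
  have [L HL] := standardized_maximin_support_gt m 0 m N c0 c1 gamma lambda
    m0 c1_gt0 lambda_gt0 gt_gamma.
  exists L => P ell phi _ ; apply: (HL P ell phi fset0); first exact: cardfs0.
  by move=> b x _ _ _; rewrite -[leqRHS](card_ord m) max_card.
rewrite -natrB ?(ltnW m_eta_lt_m)// in gt_gamma.
have [L HL] := standardized_maximin_support_gt m m_eta (m - m_eta) N c0 c1 gamma
  lambda m0 c1_gt0 lambda_gt0 gt_gamma.
exists L => P ell phi card_common minsupp.
have fin : finite_set (common_support P) by exists m_eta.
have cardC := card_fset_set card_common.
apply: (HL P ell phi (fset_set (common_support P))) => // b x Bb xinj xs.
(* Minimal support gives every local optimal design exactly m points, m_eta of them in the common
   support. *)
rewrite -cardC -[X in (X - _)%N](minsupp b Bb).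
apply: card_avoiding_le => //; apply/fsubsetP => y.
by rewrite in_fset_set// inE => /(_ b Bb).
Qed.
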